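(* There is a positive constant $c$ such that for every integer $k\ge1$, $$f(\mathbb N_k)=\sum_{\substack{n\ge 2\\ \Omega(n)=k}}\frac{1}{n\log n}\ge c.$$
   Context: $\Omega(n)$ denotes the number of prime factors of $n$ counted with multiplicity, and $\mathbb N_k=\{n:\Omega(n)=k\}$. For a set $A$ of integers $>1$, $f(A)=\sum_{a\in A}1/(a\log a)$. *)

(* Defs.v *)
From mathcomp Require Import all_boot all_order all_algebra.
From mathcomp Require Import all_classical all_reals all_analysis.
Set Implicit Arguments.
Unset Strict Implicit.
Unset Printing Implicit Defensive.
Import Order.TTheory GRing.Theory Num.Theory.
Local Open Scope classical_set_scope.
Local Open Scope ring_scope.

Definition Omega (n : nat) : nat := (\sum_(p <- primes n) logn p n)%N.

(* [primes 0] is empty, so 0 has to be excluded explicitly. *)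
Definition Nk (k : nat) : set nat := [set n | (0 < n)%N /\ Omega n = k].

(* The value lies in [0, +oo]. Elements 0 and 1 of A would contribute 0,
   since ln 0 = ln 1 = 0 and 0^-1 = 0; f is meant for sets of integers > 1. *)
Definition f (R : realType) (A : set nat) : \bar R :=
  \esum_(a in A) (1 / (a%:R * ln (a%:R : R)))%:E.

(* Main.v *)
(** Heuristically 1 / log n = \int_0^oo n^(-t) dt turns f(N_k) into an integral
    over t of P_k(1 + t), where P_k(s) is the sum of n^(-s) over Omega(n) = k.
    One has P_k >= P^k / k! with P the prime zeta function, because a product
    of k primes arises from at most k! ordered tuples, and the Euler product
    gives P(1 + t) >= log(1/t) - 3. With u = log(1/t) the integral becomes a
    Gamma integral \int u^k e^(-u) du / k!, up to a shift of u by 3, and so is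
    bounded below independently of k. The integral is replaced by a lower
    Riemann sum over the points t = e^(-j), and N_k and the primes are
    truncated, so that only finite sums occur. *)
Require Import Defs.
From mathcomp Require Import all_boot all_order all_algebra.
From mathcomp Require Import all_classical all_reals all_analysis.
From mathcomp Require Import ring lra.
Set Implicit Arguments.
Unset Strict Implicit.
Unset Printing Implicit Defensive.
Import Order.TTheory GRing.Theory Num.Theory.
Local Open Scope ring_scope.

(** * Injective reindexing and the arithmetic of [Omega] *)

(** The images form a part of [t] without repetition, and the terms left over are nonnegative. Used
    for substitutions such as [n -> p * n] and for enlarging ranges. *)
Lemma ler_sum_inj (R : numDomainType) (I J : eqType) (s : seq I) (t : seq J)
    (P : pred I) (Q : pred J) (h : I -> J) (F : J -> R) :
  uniq s -> uniq t -> {in [seq i <- s | P i] &, injective h} ->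
  (forall i, i \in s -> P i -> (h i \in t) && Q (h i)) ->
  (forall j, 0 <= F j) ->
  \sum_(i <- s | P i) F (h i) <= \sum_(j <- t | Q j) F j.
Proof.
move=> us ut injh hst F0; rewrite -[leLHS]big_filter -[leRHS]big_filter.
set s' := seq.filter P s in injh *; set t' := seq.filter Q t.
have hs : {subset map h s' <= t'}.
  move=> j /mapP[i]; rewrite mem_filter => /andP[Pi si] ->.
  by rewrite mem_filter andbC hst.
rewrite -(big_map h xpredT F) [leRHS](bigID (mem (map h s'))) /=.
rewrite -[X in _ <= X + _]big_filter.
rewrite (perm_big [seq j <- t' | j \in map h s']); last first.
  apply: uniq_perm; rewrite ?(map_inj_in_uniq injh) ?filter_uniq // => j.
  by rewrite mem_filter /=; apply/idP/andP => [js|[]//]; split=> //; exact: hs.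
by rewrite lerDl sumr_ge0.
Qed.

(** A summation range independent of [n] allows [Omega (p * n)] and [Omega n] to be compared term by
    term. *)
Lemma OmegaE (N n : nat) : (n < N)%N ->
  Omega n = (\sum_(0 <= q < N) logn q n)%N.
Proof.
move=> nN; rewrite /Omega [RHS](bigID (fun q => q \in primes n)) /=.
rewrite [X in (_ + X)%N]big1 ?addn0 => [|q]; last first.
  by rewrite -logn_gt0 -eqn0Ngt => /eqP.
rewrite -[RHS]big_filter; apply/perm_big/uniq_perm.
- exact: primes_uniq.
- by rewrite filter_uniq ?iota_uniq.
move=> q; rewrite mem_filter mem_index_iota /=.
case: (boolP (q \in primes n)) => //=; rewrite mem_primes.
by case/and3P=> _ n0 /(dvdn_leq n0) qn; rewrite (leq_ltn_trans qn).
Qed.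

Lemma Omega_primeM (p n : nat) : prime p -> (0 < n)%N ->
  Omega (p * n) = (Omega n).+1.
Proof.
move=> pp n0; have p0 := prime_gt0 pp.
rewrite (OmegaE (ltnSn (p * n))) (@OmegaE (p * n).+1); last first.
  by rewrite ltnS leq_pmull.
rewrite (eq_bigr (fun q => (q == p) + logn q n)%N) => [|q _]; last first.
  by rewrite lognM // logn_prime.
rewrite big_split /= (bigD1_seq p) ?iota_uniq //=; last first.
  by rewrite mem_index_iota ltnS leq_pmulr.
by rewrite eqxx big1 // => q /negPf ->.
Qed.

Lemma size_primes_le_Omega (n : nat) : (size (primes n) <= Omega n)%N.
Proof.
rewrite /Omega -sum1_size big_seq [leqRHS]big_seq; apply: leq_sum => p.
by rewrite logn_gt0.
Qed.

Lemma Omega1 : Omega 1 = 0%N.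
Proof. by rewrite /Omega big_nil. Qed.

Lemma count_prime_divisors_le (y n : nat) : (0 < n)%N ->
  (\sum_(0 <= p < y | prime p && (p %| n)) 1 <= Omega n)%N.
Proof.
move=> n0; apply: leq_trans (size_primes_le_Omega n).
rewrite sum1_count -size_filter; apply: uniq_leq_size.
  by rewrite filter_uniq ?iota_uniq.
by move=> q; rewrite mem_filter mem_primes n0 => /andP[].
Qed.

(** * Finite sums of a completely multiplicative function *)

Section multiplicative.
Variables (R : realFieldType) (g : nat -> R).
Hypotheses (g_ge0 : forall n, 0 <= g n) (g1 : g 1 = 1)
  (gM : forall m n, g (m * n)%N = g m * g n).

(** A number with [Omega n = k.+1] is a prime times a cofactor in at most [k.+1] ways, one for each
    prime divisor; [y * N] exceeds all the products that occur. *)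
Lemma sum_prime_mul_le (k y N : nat) :
  (\sum_(0 <= p < y | prime p) g p) *
    (\sum_(1 <= n < N | Omega n == k) g n) <=
  k.+1%:R * \sum_(1 <= n < y * N | Omega n == k.+1) g n.
Proof.
rewrite mulr_suml mulr_sumr.
apply: (@le_trans _ _ (\sum_(0 <= p < y | prime p)
  \sum_(1 <= n < y * N | (Omega n == k.+1) && (p %| n)%N) g n)).
  rewrite big_seq_cond [leRHS]big_seq_cond; apply: ler_sum => p.
  rewrite mem_index_iota /= => /andP[py pp]; have p0 := prime_gt0 pp.
  rewrite mulr_sumr [leLHS](eq_bigr (fun n => g (p * n)%N)); last first.
    by move=> n _; rewrite gM.
  apply: (@ler_sum_inj _ _ _ _ _ _ _ (muln p)); rewrite ?iota_uniq //.
    by move=> m n _ _ /eqP; rewrite eqn_pmul2l // => /eqP.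
  move=> n; rewrite !mem_index_iota => /andP[n0 nN] /eqP <-.
  rewrite Omega_primeM // eqxx dvdn_mulr // muln_gt0 p0 n0 /= andbT.
  by rewrite (@leq_trans (y * n)%N) ?ltn_pmul2r // leq_pmul2l ?(ltnW nN) //
     (leq_trans _ py).
rewrite (exchange_big_dep (fun n => Omega n == k.+1)) /=; last first.
  by move=> p n _ /andP[].
rewrite big_seq_cond [leRHS]big_seq_cond; apply: ler_sum => n.
rewrite mem_index_iota => /andP[/andP[n0 _]] /eqP On.
rewrite (eq_bigr (fun=> 1%:R * g n)) => [|? _]; last by rewrite mul1r.
rewrite -mulr_suml -natr_sum ler_wpM2r // ler_nat.
under eq_bigl do rewrite On eqxx /=.
by rewrite -On count_prime_divisors_le.
Qed.

(** Iteration multiplies the factors [k.+1] into the factorial: this is [P^k <= k! P_k]. The factor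
    2 in the range keeps the term [n = 1] when [k = 0]. *)
Lemma sum_prime_expn_le (k y : nat) :
  (\sum_(0 <= p < y | prime p) g p) ^+ k <=
  k`!%:R * \sum_(1 <= n < y ^ k * 2 | Omega n == k) g n.
Proof.
have G0 : 0 <= \sum_(0 <= p < y | prime p) g p by apply: sumr_ge0.
elim: k => [|k IH].
  by rewrite expn0 mul1n [X in _ * X]big_mkcond big_nat1 Omega1 /= g1 expr0
    mul1r.
rewrite exprS; apply: le_trans (ler_wpM2l G0 IH) _.
by rewrite mulrCA factS (mulnC k.+1) natrM -mulrA ler_wpM2l // expnS -mulnA
  sum_prime_mul_le.
Qed.

(* Induction on m: for m prime, the (m+1)-smooth n divisible by m are m n' with
   n' again (m+1)-smooth, so A(m+1) <= A(m) + g m * A(m+1) for the sums A. *)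
Lemma smooth_sum_euler (m N : nat) : (forall p, prime p -> g p <= 1) ->
  (\sum_(1 <= n < N | all (fun q => (q < m)%N) (primes n)) g n) *
    \prod_(0 <= p < m | prime p) (1 - g p) <= 1.
Proof.
move=> gp1; elim: m => [|m IH].
  (* For [m = 0] only [n = 1] remains. *)
  rewrite big_nil mulr1 -[leRHS](_ : \sum_(i <- [:: 1%N]) g i = 1); last first.
    by rewrite big_seq1.
  apply: (@ler_sum_inj _ _ _ _ _ _ _ id); rewrite ?iota_uniq // => n.
  rewrite mem_index_iota => /andP[n0 _]; case E: (primes n) => [|//] _.
  move/eqP: E; rewrite primes_eq0 => n2.
  by rewrite andbT mem_seq1 eqn_leq n0 andbT -ltnS.
rewrite [X in _ * X]big_mkcond big_nat_recr //= -big_mkcond /=.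
case: ifPn => [pm|npm]; last first.
  rewrite mulr1; under eq_bigl => n.
    rewrite (_ : all _ _ = all (fun q => (q < m)%N) (primes n)); first over.
    apply: eq_in_all => q; rewrite mem_primes => /and3P[pq _ _].
    by rewrite ltnS leq_eqVlt; case: eqP pq npm => // -> ->.
  exact: IH.
(* It remains to show [A(m+1) * (1 - g m) <= A(m)]. *)
rewrite mulrCA; apply: le_trans IH; rewrite [leRHS]mulrC.
apply: ler_wpM2l; first by apply: prodr_ge0 => p /gp1; rewrite subr_ge0.
rewrite mulrBr mulr1 lerBlDr [leLHS](bigID (fun n => (m %| n)%N)) /= addrC.
apply: lerD.
  apply: (@ler_sum_inj _ _ _ _ _ _ _ id); rewrite ?iota_uniq // => n.
  rewrite mem_index_iota => /andP[n0 ->]; rewrite n0 /= => /andP[/allP h mn].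
  apply/allP => q qn; have := h q qn; rewrite ltnS leq_eqVlt => /orP[/eqP qm|//].
  by move: qn; rewrite qm mem_primes (negPf mn) !andbF.
rewrite mulr_suml (eq_bigr (fun n => g (n %/ m)%N * g m)); last first.
  by move=> n /andP[_ mn]; rewrite -gM divnK.
apply: (@ler_sum_inj _ _ _ _ _ _ _ (fun n => n %/ m)%N (fun n => g n * g m)).
- exact: iota_uniq.
- exact: iota_uniq.
- move=> a b; rewrite !mem_filter => /andP[/andP[_ ma] _] /andP[/andP[_ mb] _].
  by move=> /(congr1 (muln m)); rewrite ![(m * _)%N]mulnC !divnK.
- move=> n; rewrite !mem_index_iota => /andP[n0 nN] /andP[/allP h mn].
  have m0 := prime_gt0 pm.
  rewrite divn_gt0 // dvdn_leq //= (leq_ltn_trans (leq_div _ _)) //=.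
  apply/allP => q qn; apply: h; move: qn; rewrite !mem_primes.
  by move=> /and3P[-> _ qn]; rewrite n0 (dvdn_trans qn) // dvdn_div.
- by move=> j; rewrite mulr_ge0.
Qed.

Lemma sum_euler (N : nat) : (forall p, prime p -> g p <= 1) ->
  (\sum_(1 <= n < N) g n) * \prod_(0 <= p < N | prime p) (1 - g p) <= 1.
Proof.
move=> gp1; apply: le_trans (smooth_sum_euler N N gp1).
rewrite ler_wpM2r //; first by apply: prodr_ge0 => p /gp1; rewrite subr_ge0.
apply: (@ler_sum_inj _ _ _ _ _ _ _ id); rewrite ?iota_uniq // => n.
rewrite mem_index_iota => /andP[n0 nN] _; rewrite n0 nN; apply/allP => q.
by rewrite mem_primes => /and3P[_ _ /(dvdn_leq n0) qn]; exact: leq_ltn_trans nN.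
Qed.

End multiplicative.

(** * Riemann sums and Gamma tails *)

Section real_estimates.
Variable R : realType.
Implicit Types (t x s : R) (a : nat -> R).

(* A lower Riemann sum for 1 / x = \int_0^oo e^(- t x) dt. *)
Lemma sum_expR_le_inv a (J : nat) x : 0 < x -> (forall j, 0 <= a j) ->
  \sum_(0 <= j < J) (a j - a j.+1) * expR (- (a j * x)) <= x^-1.
Proof.
move=> x0 a0; rewrite -[leRHS]mul1r ler_pdivlMr // mulr_suml.
apply: (@le_trans _ _ (\sum_(0 <= j < J)
    (expR (- (a j.+1 * x)) - expR (- (a j * x))))).
  apply: ler_sum => j _.
  (* With [d = (a j - a j.+1) * x], the bound [1 + d <= e^d] compares each term with a telescoping
     difference. *)
  have -> : - (a j.+1 * x) = (a j - a j.+1) * x + - (a j * x) by ring.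
  have := expR_ge1Dx ((a j - a j.+1) * x); have := expR_gt0 (- (a j * x)).
  rewrite expRD; nra.
rewrite telescope_sumr //.
have := expR_ge0 (- (a 0 * x)).
have : expR (- (a J * x)) <= 1 by rewrite -expR0 ler_expR oppr_le0 mulr_ge0 // ltW.
lra.
Qed.

(* Tails of Gamma integrals: -\sum_(m <= k) poisson m is a primitive of
   poisson k. *)
Definition poisson (m : nat) t : R := expR (- t) * (t ^+ m / m`!%:R).

Lemma is_derive_expRN t : is_derive t 1 (fun u => expR (- u)) (- expR (- t)).
Proof.
rewrite (_ : (fun _ => _) = expR \o -%R)//.
by apply: is_derive_eq; rewrite mulrN1.
Qed.

Lemma is_derive_poisson0 t : is_derive t 1 (poisson 0) (- poisson 0 t).
Proof.
rewrite (_ : poisson 0 = (fun u => expR (- u))); last first.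
  by apply/funext => u; rewrite /poisson expr0 fact0 divr1 mulr1.
exact: is_derive_expRN.
Qed.

Lemma is_derive_poissonS m t :
  is_derive t 1 (poisson m.+1) (poisson m t - poisson m.+1 t).
Proof.
rewrite (_ : poisson m.+1 =
  (fun u => expR (- u)) * (m.+1`!%:R^-1 *: (@id R ^+ m.+1))); last first.
  by apply/funext => u; rewrite /poisson !fctE mulrC [in RHS]mulrC
    [_^-1 *: _]mulrC.
have h := is_derive_expRN t.
apply: is_derive_eq; rewrite /poisson !fctE /GRing.scale /= factS natrM exprS.
by field; rewrite nat1r !pnatr_eq0 -lt0n fact_gt0.
Qed.

(** The derivatives [poisson m - poisson m.+1] telescope. *)
Lemma is_derive_sum_poisson k t :
  is_derive t 1 (fun t => - \sum_(0 <= m < k.+1) poisson m t) (poisson k t).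
Proof.
elim: k => [|k IH].
  rewrite (_ : (fun _ => _) = - poisson 0); last first.
    by apply/funext => u; rewrite big_nat1.
  have h := is_derive_poisson0 t; apply: is_derive_eq; exact: opprK.
rewrite (_ : (fun _ => _) =
    (fun t => - \sum_(0 <= m < k.+1) poisson m t) - poisson k.+1); last first.
  by apply/funext => u; rewrite big_nat_recr //= opprD.
have h := is_derive_poissonS k t; apply: is_derive_eq; ring.
Qed.

(** The left side is the integral of [poisson k] over [[i, i+1]], hence a value [poisson k c]; there
    [c^k <= (i+1)^k] and [e^(-c) <= e * e^(-(i+1))]. *)
Lemma sum_poissonB_le k (i : nat) :
  \sum_(0 <= m < k.+1) poisson m i%:R - \sum_(0 <= m < k.+1) poisson m i.+1%:R
  <= expR 1 * poisson k i.+1%:R.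
Proof.
have lti : i%:R < i.+1%:R :> R by rewrite ltr_nat.
have [|c] := MVT lti (fun t _ => is_derive_sum_poisson k t).
  apply: derivable_within_continuous => t _.
  by have [] := is_derive_sum_poisson k t.
rewrite in_itv /= => /andP[ic ci].
rewrite -natr1 addrAC subrr add0r mulr1 opprK addrC => ->.
have c0 : 0 <= c by apply: le_trans (ltW ic).
rewrite /poisson [leRHS]mulrA -expRD.
apply: ler_pM; rewrite ?expR_ge0 ?divr_ge0 ?exprn_ge0 //.
  by rewrite ler_expR; move: ic; lra.
by rewrite ler_wpM2r ?invr_ge0 // lerXn2r ?nnegrE ?natr1 // ltW // natr1.
Qed.

(** [e^J >= J^(m+1) / (m+1)!] gives [poisson m J <= (m+1) / J], so the sum is at most
    [(k+1)^2 / J]. *)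
Lemma sum_poisson_small k : exists J : nat,
  \sum_(0 <= m < k.+1) poisson m J%:R <= 2^-1.
Proof.
exists (2 * k.+1 ^ 2)%N; set J := (2 * _)%N.
have J0 : 0 < J%:R :> R by rewrite ltr0n.
apply: (@le_trans _ _ (\sum_(0 <= m < k.+1) k.+1%:R / J%:R)).
  rewrite big_nat [leRHS]big_nat; apply: ler_sum => m /andP[_ mk].
  have := expR_ge1Dxn m (ltW J0).
  rewrite /poisson expRN => h; rewrite mulrC ler_pdivrMr ?expR_gt0 //.
  apply: (@le_trans _ _ (k.+1%:R / J%:R * (J%:R ^+ m.+1 / m.+1`!%:R))); last first.
    by rewrite ler_wpM2l ?divr_ge0 //; move: h; lra.
  rewrite exprS factS natrM.
  have -> : k.+1%:R / J%:R * (J%:R * J%:R ^+ m / (m.+1%:R * m`!%:R)) =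
     k.+1%:R / m.+1%:R * (J%:R ^+ m / m`!%:R) :> R.
    by field; rewrite ?gt_eqF //= ?ltr0n ?fact_gt0 //.
  rewrite ler_peMl ?divr_ge0 ?exprn_ge0 //.
  by rewrite ler_pdivlMr ?ltr0n // mul1r ler_nat.
rewrite sumr_const_nat subn0 /J natrM natrX -mulr_natr le_eqVlt; apply/orP; left.
apply/eqP; field; rewrite ?pnatr_eq0 //.
Qed.

(** The sum of [poisson m] over [m <= k] falls from 1 at 0 to at most 1/2 at [J], and the step from
    [i] to [i.+1] loses at most [e * poisson k i.+1]. [J] depends on [k], the bound does not. *)
Lemma sum_poisson_ge k : exists J : nat,
  (2 * expR 1)^-1 <= \sum_(0 <= i < J) poisson k i.+1%:R.
Proof.
have [J hJ] := sum_poisson_small k; exists J.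
rewrite invfM mulrC ler_pdivrMl ?expR_gt0 // mulr_sumr.
pose S (i : nat) := - \sum_(0 <= m < k.+1) poisson m i%:R.
apply: (@le_trans _ _ (\sum_(0 <= i < J) (S i.+1 - S i))); last first.
  by apply: ler_sum => i _; rewrite /S opprK addrC; exact: sum_poissonB_le.
rewrite telescope_sumr // /S.
suff : \sum_(0 <= m < k.+1) poisson m 0%:R = 1 by move: hJ; lra.
rewrite big_nat_recl // big1 ?addr0 => [|m _].
  by rewrite /poisson oppr0 expR0 expr0 fact0 divr1 mulr1.
by rewrite /poisson expr0n /= mul0r mulr0.
Qed.

End real_estimates.

(** * The prime zeta function near 1 *)

(** [1 / p^2 <= 1 / (p-1) - 1 / p] telescopes from [p = 2] on. *)
Lemma sum_inv_sqr_le (R : realFieldType) (N : nat) :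
  \sum_(0 <= p < N | prime p) (p%:R^-1 ^+ 2 : R) <= 1.
Proof.
rewrite big_mkcond; case: N => [|[|N]]; [by rewrite big_geq|by rewrite big_nat1|].
rewrite big_ltn // big_ltn // /= !add0r.
apply: (@le_trans _ _ (\sum_(2 <= p < N.+2) (p.-1%:R^-1 - p%:R^-1 : R))).
  rewrite big_nat [leRHS]big_nat; apply: ler_sum => p /andP[p2 _].
  have p1 : 1 <= p.-1%:R :> R by rewrite ler1n; case: p p2 => [|[]].
  have -> : p%:R = p.-1%:R + 1 :> R by rewrite natr1 prednK // ltnW.
  have -> : p.-1%:R^-1 - (p.-1%:R + 1)^-1 = p.-1%:R^-1 * (p.-1%:R + 1)^-1 :> R.
    by field; lra.
  have x0 : 0 <= (p.-1%:R + 1)^-1 :> R by rewrite invr_ge0; lra.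
  case: ifP => _; last by rewrite mulr_ge0 // invr_ge0; lra.
  by rewrite expr2 ler_wpM2r // lef_pV2 ?posrE; lra.
rewrite (@telescope_sumr_eq _ 2 N.+2 (fun p => - p.-1%:R^-1)) //=; last first.
  by move=> p _; rewrite opprK addrC.
by rewrite invr1 opprK addrC lerBlDr lerDl invr_ge0.
Qed.

Lemma powR_natM (R : realType) (r : R) (m n : nat) :
  (m * n)%:R `^ r = m%:R `^ r * n%:R `^ r.
Proof. by rewrite natrM powRM. Qed.

Lemma powR_opp1D (R : realType) (s : R) (n : nat) : (0 < n)%N ->
  n%:R `^ (- (1 + s)) = n%:R^-1 * expR (- (s * ln n%:R)).
Proof.
move=> n0; rewrite opprD powRD; last by rewrite pnatr_eq0 -lt0n n0 implybT.
by rewrite powR_inv1 // /powR pnatr_eq0 gtn_eqF // mulNr.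
Qed.

Section zeta.
Variables (R : realType) (s : R).
Hypothesis s0 : 0 < s.

Let g (n : nat) : R := n%:R `^ (- (1 + s)).

Let g_ge0 n : 0 <= g n. Proof. exact: powR_ge0. Qed.

Let gM := powR_natM (- (1 + s)).

Let g1 : g 1 = 1. Proof. by rewrite /g powR1. Qed.

Let gE := powR_opp1D s.

Let g_le n : (0 < n)%N -> g n <= n%:R^-1.
Proof.
move=> n0; rewrite /g gE // ler_piMr // -[leRHS]expR0 ler_expR oppr_le0.
by rewrite mulr_ge0 ?(ltW s0) // ln_ge0 // ler1n.
Qed.

(** Discrete comparison with the integral of [x^(-1-s)] over [[1, N]]:
    [n^(-s) - (n+1)^(-s) <= s n^(-1-s)], summed by telescoping. *)
Lemma zeta_partial_ge (N : nat) : (0 < N)%N ->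
  (1 - expR (- (s * ln N%:R))) / s <= \sum_(1 <= n < N) g n.
Proof.
move=> N0; rewrite ler_pdivrMr // mulr_suml.
have -> : 1 - expR (- (s * ln N%:R)) =
    \sum_(1 <= n < N) (- expR (- (s * ln n.+1%:R)) - - expR (- (s * ln n%:R))).
  rewrite (telescope_sumr (fun n => - expR (- (s * ln n%:R)))) //.
  by rewrite ln1 mulr0 oppr0 expR0 opprK addrC.
rewrite big_nat [leRHS]big_nat; apply: ler_sum => n /andP[n0 _].
have nR : 0 < n%:R :> R by rewrite ltr0n.
have hl : ln n.+1%:R <= ln n%:R + n%:R^-1 :> R.
  rewrite (_ : n.+1%:R = n%:R * (1 + n%:R^-1)); last first.
    by rewrite mulrDr mulr1 divff ?gt_eqF // natr1.
  rewrite lnM ?posrE ?addr_gt0 ?invr_gt0 // lerD2l le_ln1Dx //.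
  by apply: lt_trans (_ : 0 < _); rewrite ?invr_gt0 // ltrN10.
rewrite /g gE //; set A := expR (- (s * ln n%:R)).
have : A * (1 - s / n%:R) <= expR (- (s * ln n.+1%:R)).
  apply: (@le_trans _ _ (A * expR (- (s / n%:R)))).
    by rewrite ler_wpM2l ?expR_ge0 //; exact: expR_ge1Dx.
  rewrite /A -expRD ler_expR -opprD lerN2 -mulrDr ler_wpM2l // ltW //.
have -> : n%:R^-1 * A * s = A * (s / n%:R) by ring.
lra.
Qed.

(** Logarithm of the Euler product: [1 - x >= e^(-(x + 2 x^2))] for [0 <= x <= 1/2], and the squares
    cost at most 2 by [sum_inv_sqr_le]. *)
Lemma zeta_partial_le (N : nat) :
  \sum_(1 <= n < N) g n <= expR (\sum_(0 <= p < N | prime p) g p + 2).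
Proof.
have gp p : prime p -> g p <= p%:R^-1 /\ g p <= 2^-1.
  move=> pp; have gpp := g_le (prime_gt0 pp); split => //.
  by rewrite (le_trans gpp) // lef_pV2 ?posrE ?ltr0n ?prime_gt0 // ler_nat
    prime_gt1.
have gp1 p : prime p -> g p <= 1 by move=> /gp[_]; lra.
have := sum_euler g_ge0 g1 gM N gp1.
set Z := \sum_(1 <= n < N) g n; set S := \sum_(0 <= p < N | _) _.
have Z0 : 0 <= Z by exact: sumr_ge0.
suff h : expR (- (S + 2)) <= \prod_(0 <= p < N | prime p) (1 - g p).
  move=> H; have : Z * expR (- (S + 2)) <= 1
    by apply: le_trans H; rewrite ler_wpM2l.
  by rewrite expRN ler_pdivrMr ?expR_gt0 // mul1r.
apply: (@le_trans _ _ (expR (- \sum_(0 <= p < N | prime p) (g p + 2 * g p ^+ 2)))).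
  rewrite ler_expR lerN2 big_split /= lerD2l -mulr_sumr ler_piMr //.
  apply: le_trans (sum_inv_sqr_le R N); apply: ler_sum => p /gp[gpp _].
  by rewrite lerXn2r ?nnegrE ?invr_ge0.
rewrite -sumrN expR_sum; apply: ler_prod => p pp.
rewrite expR_ge0 expRN -[leLHS]mul1r ler_pdivrMr ?expR_gt0 //=.
have [_ h] := gp p pp; have := g_ge0 p; move: h; set x := g p => x2 x0.
(* The product equals [1 + x^2 (1 - 2 x)]. *)
apply: (@le_trans _ _ ((1 - x) * (1 + (x + 2 * x ^+ 2)))); first by nra.
by rewrite ler_wpM2l ?expR_ge1Dx // subr_ge0; lra.
Qed.

(** For [N >= e^(1/s)] the lower bound for zeta is at least [(1 - e^(-1)) / s >= e^(-1) / s]; in the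
    logarithm this loses 1, and [zeta_partial_le] loses 2. *)
Lemma prime_sum_ge : exists N0 : nat, forall N, (N0 <= N)%N ->
  - ln s - 3 <= \sum_(0 <= p < N | prime p) g p.
Proof.
exists (Num.truncn (expR s^-1)).+1 => N N0N.
have eN : expR s^-1 <= N%:R.
  by apply: ltW; apply: lt_le_trans (truncnS_gt _) _; rewrite ler_nat.
have N0 : (0 < N)%N by exact: leq_trans N0N.
have lN : 1 <= s * ln N%:R.
  rewrite mulrC -ler_pdivrMr // mul1r -[leLHS]expRK ler_ln ?posrE ?expR_gt0 ?ltr0n //.
have := le_trans (zeta_partial_ge N0) (zeta_partial_le N).
set S := \sum_(0 <= p < N | _) _ => h.
have e1 : expR (- 1) <= 1 - expR (- (s * ln N%:R)).
  have : expR (- (s * ln N%:R)) <= expR (- 1) by rewrite ler_expR lerN2.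
  have : expR (- 1) <= 2^-1 :> R.
    by rewrite expRN lef_pV2 ?posrE ?expR_gt0 //; have := expR_ge1Dx (1 : R); lra.
  lra.
have : expR (- 1 - ln s) <= expR (S + 2).
  apply: le_trans h; rewrite expRB lnK ?posrE // ler_wpM2r ?invr_ge0 // ltW //.
by rewrite ler_expR; lra.
Qed.

End zeta.

(** * Lower bound for a truncation of the series, and the theorem *)

(** The first two factors of the constant come from the weights [a i - a i.+1 = (1 - e^(-1)) e^(-3)
    e^(-(i+1))], the third from [sum_poisson_ge]. *)
Lemma sum_Omega_ge (R : realType) (k : nat) : (1 <= k)%N -> exists N : nat,
  (1 - expR (- 1)) * expR (- 3%:R) * (2 * expR 1)^-1 <=
  \sum_(2 <= n < N | Omega n == k) 1 / (n%:R * ln n%:R) :> R.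
Proof.
move=> k1; have [J hJ] := sum_poisson_ge R k.
(* The shift by 4 makes the lower bound - ln (a i) - 3 equal to i + 1. *)
pose a (i : nat) : R := expR (- (i + 4)%:R).
have a0 i : 0 < a i by exact: expR_gt0.
have aB i : a i - a i.+1 = (1 - expR (- 1)) * expR (- 3%:R) * expR (- i.+1%:R).
  rewrite -mulrA -expRD -opprD -natrD addnC addSnnS -/(a i) mulrBl mul1r.
  by rewrite /a -expRD -opprD nat1r.
have aB0 i : 0 <= a i - a i.+1.
  by rewrite subr_ge0 ler_expR lerN2 ler_nat.
have [N0 hN0] := choice (fun i => prime_sum_ge (a0 i)).
(* A single truncation [y] beyond the thresholds of all [J] points. *)
pose y := (\max_(i < J) N0 i)%N; exists (y ^ k * 2)%N; set N := (y ^ k * 2)%N.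
have hP i : (i < J)%N -> i.+1%:R ^+ k / k`!%:R <=
    \sum_(2 <= n < N | Omega n == k) (n%:R `^ (- (1 + a i)) : R).
  move=> iJ; rewrite ler_pdivrMr ?ltr0n ?fact_gt0 // mulrC.
  have yi : (N0 i <= y)%N by exact:
    (leq_bigmax (F := fun i : 'I_J => N0 i) (Ordinal iJ)).
  have := hN0 i y yi; rewrite /a expRK opprK => h.
  have {}h : i.+1%:R <= \sum_(0 <= p < y | prime p) (p%:R `^ (- (1 + a i)) : R).
    by apply: le_trans h; rewrite natrD -natr1; lra.
  apply: (@le_trans _ _ ((\sum_(0 <= p < y | prime p) p%:R `^ (- (1 + a i))) ^+ k)).
    by rewrite lerXn2r ?nnegrE // (le_trans _ h).
  have g1 : 1 `^ (- (1 + a i)) = 1 :> R by rewrite powR1.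
  have := @sum_prime_expn_le R (fun n => n%:R `^ (- (1 + a i)))
    (fun=> powR_ge0 _ _) g1 (powR_natM _) k y.
  move=> /le_trans; apply; rewrite ler_wpM2l //.
  apply: (@ler_sum_inj _ _ _ _ _ _ _ id); rewrite ?iota_uniq // => n.
  rewrite !mem_index_iota => /andP[n0 ->] On; rewrite On !andbT.
  (* The range loses [n = 1], but [Omega 1 = 0 < k]. *)
  by case: n n0 On => [|[|]] //; rewrite Omega1 => _ /eqP k0; rewrite -k0 in k1.
(* By [aB] and [hP] each summand is at least the first two factors times [poisson k i.+1]. *)
apply: (@le_trans _ _ (\sum_(0 <= i < J) (a i - a i.+1) *
    \sum_(2 <= n < N | Omega n == k) n%:R `^ (- (1 + a i)))).
  apply: le_trans (ler_wpM2l _ hJ) _.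
    rewrite mulr_ge0 ?expR_ge0 // subr_ge0 -[leRHS]expR0 ler_expR; lra.
  rewrite mulr_sumr big_nat [leRHS]big_nat; apply: ler_sum => i /andP[_ iJ].
  by rewrite /poisson [leLHS]mulrA -aB ler_wpM2l ?hP.
rewrite [leLHS](eq_bigr (fun i => \sum_(2 <= n < N | Omega n == k)
  (a i - a i.+1) * n%:R `^ (- (1 + a i)))) => [|i _]; last by rewrite mulr_sumr.
(* For fixed [n] the inner sum is now [1 / n] times the Riemann sum for [1 / ln n]. *)
rewrite exchange_big /= big_nat_cond [leRHS]big_nat_cond.
apply: ler_sum => n /andP[/andP[n2 _] _].
have n0 : (0 < n)%N by exact: ltnW.
rewrite (eq_bigr (fun i => n%:R^-1 *
  ((a i - a i.+1) * expR (- (a i * ln n%:R))))) => [|i _]; last first.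
  by rewrite powR_opp1D // mulrCA.
rewrite -mulr_sumr mul1r invfM ler_wpM2l ?invr_ge0 //.
apply: sum_expR_le_inv => [|j]; last exact: ltW.
by rewrite ln_gt0 // ltr1n.
Qed.

Theorem theorem1p5 (R : realType) :
  exists c : R, 0 < c /\
    forall k : nat, (1 <= k)%N ->
      f R (Nk k) =
        (\sum_(2 <= n <oo | Omega n == k) (1 / (n%:R * ln (n%:R : R)))%:E)%E
      /\ (c%:E <= f R (Nk k))%E.
Proof.
exists ((1 - expR (- 1)) * expR (- 3%:R) * (2 * expR 1)^-1); split.
  have e1 : expR (- 1) < 1 :> R by rewrite -[ltRHS]expR0 ltr_expR ltrN10.
  by rewrite !mulr_gt0 ?invr_gt0 ?mulr_gt0 ?expR_gt0 ?subr_gt0.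
move=> k k1.
have F0 n : (0 <= (1 / (n%:R * ln (n%:R : R)))%:E)%E.
  rewrite lee_fin mul1r invr_ge0 mulr_ge0 //.
  by case: n => [|n]; [rewrite ln0|rewrite ln_ge0 // ler1n].
have fE : f R (Nk k) =
    (\sum_(2 <= n <oo | Omega n == k) (1 / (n%:R * ln (n%:R : R)))%:E)%E.
  rewrite eseries_cond nneseries_esum //; congr esum; apply/seteqP; split=> n /=.
    move=> [n0 On]; rewrite On eqxx /=.
    (* [k >= 1] excludes [n = 1], so the sum may start at 2. *)
    by case: n n0 On => [|[|]] //; rewrite Omega1 => _ k0; rewrite -k0 in k1.
  by move=> /andP[/eqP On n2]; split => //; exact: ltnW.
split=> //; rewrite fE; have [N hN] := sum_Omega_ge R k1.
apply: le_trans (nneseries_lim_ge N _) => [|n _ _]; last exact: F0.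
by rewrite sumEFin lee_fin.
Qed.
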